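(* Let $F$ be a binary octic form with real coefficients and no real roots. Assume that its upper-half-plane roots $\alpha_1,\alpha_2,\alpha_3,\alpha_4\in\mathbb H^2$ (with multiplicity) lie on the same hyperbolic geodesic, and let $P\in\mathbb H^2$. Then $\xi_{\mathcal J}(F)=\xi_{\mathcal H}(F)=P$ if and only if the four points $\alpha_1,\alpha_2,\alpha_3,\alpha_4$ can be split into two pairs each having $P$ as its hyperbolic midpoint.
   Context: $\mathbb H^2=\{x+iy:y>0\}$ is the upper half-plane with hyperbolic distance $d_H$, $\cosh d_H(x+iy,u+iv)=1+\frac{(x-u)^2+(y-v)^2}{2yv}$. The hyperbolic midpoint of two equal points is that point. A real binary form of degree $2n$ with no real roots (in $\mathbb P^1(\mathbb R)$) factors as $F(X,Z)=a_0\prod_{i=1}^n (X-\alpha_iZ)(X-\overline{\alpha_i}Z)$ with $a_0\in\mathbb R\setminus\{0\}$; $\alpha_1,\ldots,\alpha_n\in\mathbb H^2$ are its upper-half-plane roots (with multiplicity). Julia's zero $\xi_{\mathcal J}(F)$: let $\mathbb H^3=\{z+t\mathbf{j}: z\in\mathbb C,\ t>0\}$, with $\mathbb H^2\subset\mathbb H^3$ via $x+iy\mapsto x+y\mathbf{j}$, and for $w=z+t\mathbf{j}$, $\alpha\in\mathbb C$ put $d_H(w,\alpha)=\ln\frac{|z-\alpha|^2+t^2}{t}$. A form of degree $N$ is stable if none of its roots has multiplicity at least $N/2$. For stable $F$ with all complex roots $\beta_1,\ldots,\beta_{2n}$ (with multiplicity), $\xi_{\mathcal J}(F)$ is the unique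 point $w\in\mathbb H^3$ minimizing $\sum_{i=1}^{2n} d_H(w,\beta_i)$; for real $F$ with no real roots it lies in $\mathbb H^2$. If such an $F$ is not stable, then all $\alpha_i$ equal one point $\alpha$ and by convention $\xi_{\mathcal J}(F)=\alpha$. Hyperbolic zero $\xi_{\mathcal H}(F)$: it is the hyperbolic center of mass of $\alpha_1,\ldots,\alpha_n$, i.e. the unique point $Q\in\mathbb H^2$ minimizing $\sum_{i=1}^n\cosh d_H(Q,\alpha_i)$. *)

(* Defs.v *)
From HB Require Import structures.
From mathcomp Require Import all_boot all_order all_algebra.
From mathcomp Require Import all_classical all_reals all_analysis.
From mathcomp Require Import complex.
From mathcomp Require mpoly.
(* The notations of [mpoly] clash with those of the analysis library. *)
Import (canonicals, coercions) mpoly.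

Set Implicit Arguments.
Unset Strict Implicit.
Unset Printing Implicit Defensive.

Import Order.TTheory GRing.Theory Num.Theory.

Local Open Scope classical_set_scope.
Local Open Scope complex_scope.
Local Open Scope ring_scope.

(** * Hyperbolic plane and space *)

Record H2 (R : realType) := MkH2 {
  H2val :> R[i];
  H2P : 0 < complex.Im H2val }.

HB.instance Definition _ (R : realType) := [isSub for @H2val R].
HB.instance Definition _ (R : realType) := [Choice of H2 R by <:].

(* The pair (z, t) stands for the point z + t j. *)
Record H3 (R : realType) := MkH3 {
  H3val :> R[i] * R;
  H3P : 0 < H3val.2 }.

HB.instance Definition _ (R : realType) := [isSub for @H3val R].
HB.instance Definition _ (R : realType) := [Choice of H3 R by <:].

(* x + i y is sent to x + y j. *)
Definition H2_to_H3 (R : realType) (P : H2 R) : H3 R :=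
  @MkH3 R ((complex.Re P)%:C, complex.Im P) (H2P P).

(* i in H^2; serves only as a default value. *)
Definition H2_i (R : realType) : H2 R := @MkH2 R (Complex 0 1) ltr01.

Definition cosh (R : realType) (x : R) : R := (expR x + expR (- x)) / 2.

Definition arcosh (R : realType) (u : R) : R := ln (u + Num.sqrt (u ^+ 2 - 1)).

Definition dist_H2 (R : realType) (P Q : H2 R) : R :=
  let x := complex.Re P in let y := complex.Im P in
  let u := complex.Re Q in let v := complex.Im Q in
  arcosh (1 + ((x - u) ^+ 2 + (y - v) ^+ 2) / (2 * y * v)).

(* The images of R under distance-preserving maps, i.e. complete geodesics. *)
Definition is_geodesic (R : realType) (L : set (H2 R)) : Prop :=
  exists2 g : R -> H2 R,
    (forall s t, dist_H2 (g s) (g t) = `|s - t|) & L = range g.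

Definition is_midpoint (R : realType) (A B M : H2 R) : Prop :=
  dist_H2 A M = dist_H2 A B / 2 /\ dist_H2 M B = dist_H2 A B / 2.

(* ln ((|z - a|^2 + t^2) / t) for w = z + t j in H^3 and a in C. *)
Definition dist_H3_bdry (R : realType) (w : H3 R) (a : R[i]) : R :=
  let z := (H3val w).1 in let t := (H3val w).2 in
  ln ((complex.Re (z - a) ^+ 2 + complex.Im (z - a) ^+ 2 + t ^+ 2) / t).

Definition unique_minimizers (R : realType) (T : Type) (f : T -> R) : set T :=
  [set w | forall v, v <> w -> f w < f v].

(** * Binary forms and their roots *)

(* Variables number 0 and 1 are X and Z. *)
Definition binary_form (R : nzRingType) (d : nat) (F : mpoly.mpoly 2 R) : Prop :=
  F \is mpoly.ishomog1 d (@mpoly.mdeg 2).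

Definition form_eval (R : nzRingType) (F : mpoly.mpoly 2 R) (x z : R) : R :=
  mpoly.meval (tnth [tuple x; z]) F.

Definition no_real_root (R : realType) (F : mpoly.mpoly 2 R) : Prop :=
  forall x z : R, form_eval F x z = 0 -> x = 0 /\ z = 0.

(* F(X, 1) *)
Definition dehomogenize (R : realType) (F : mpoly.mpoly 2 R) : {poly R[i]} :=
  mpoly.mmap (polyC \o real_complex R) (tnth [tuple 'X; 1]) F.

(* The finite roots in P^1(C), with multiplicity. If F is a nonzero form of
   degree d, its root at infinity has multiplicity d minus the size of this
   list. *)
Definition complex_roots (R : realType) (F : mpoly.mpoly 2 R) : seq R[i] :=
  sval (closed_field_poly_normal (dehomogenize F)).

Definition upper_roots (R : realType) (F : mpoly.mpoly 2 R) : seq (H2 R) :=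
  pmap insub (complex_roots F).

Definition stable (R : realType) (d : nat) (F : mpoly.mpoly 2 R) : bool :=
  let s := complex_roots F in
  ((d - size s).*2 < d)%N && all (fun b => ((count_mem b s).*2 < d)%N) s.

(** * The two zero maps, for real forms without real roots *)

(* A non-stable form without real roots has all its upper roots equal; the
   first of them is then their common value. *)
Definition julia_zero (R : realType) (d : nat) (F : mpoly.mpoly 2 R) : H3 R :=
  if stable d F then
    xget (H2_to_H3 (H2_i R))
      (unique_minimizers
         (fun w : H3 R => \sum_(b <- complex_roots F) dist_H3_bdry w b))
  else H2_to_H3 (head (H2_i R) (upper_roots F)).

Definition hyperbolic_zero (R : realType) (F : mpoly.mpoly 2 R) : H2 R :=
  xget (H2_i R)
    (unique_minimizers
       (fun Q : H2 R => \sum_(a <- upper_roots F) cosh (dist_H2 Q a))).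

(* Main.v *)
Require Import Defs.
From mathcomp Require Import all_boot all_order all_algebra.
From mathcomp Require Import all_classical all_reals all_analysis.
From mathcomp Require Import complex.
From mathcomp Require mpoly.
From mathcomp Require Import ring lra.
Set Implicit Arguments.
Unset Strict Implicit.
Unset Printing Implicit Defensive.
Import Order.TTheory GRing.Theory Num.Theory numFieldNormedType.Exports.
Local Open Scope classical_set_scope.
Local Open Scope ring_scope.

(** Since a form without real roots has its complex roots paired by conjugation,
    everything can be read off the four upper roots, which lie at positions
    [x_i] on a unit-speed geodesic [g].

    In the model of the hyperbolic plane by positive definite binary quadratic
    forms of determinant [1], [cosh] of the distance is a bilinear (Minkowski)
    product, and [g] is the curve [cosh s *: u + sinh s *: e].
    Hence the cosh-distance from any [Q] to [g (p + s)] is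
    [A cosh s - B sinh s] with [A] the cosh-distance from [Q] to [g p] and
    [A ^ 2 >= 1 + B ^ 2] (lemma [cosh_dist_along]). Two consequences follow.

    If [sinh (x_i - p)] sums to [0], the sum of the cosh-distances from [Q] is
    [A] times its value at [g p], so [g p] is the hyperbolic zero
    (lemma [hyperbolic_minimizer]).

    If [tanh (x_i - p)] sums to [0], then [g p] is Julia's zero
    (lemma [julia_minimizer]). Indeed the contributions of a root and of its
    conjugate at a point of the upper half-space are together at least those at
    the nearest point of the half-plane, and on the half-plane they amount, up
    to a constant, to twice the logarithm of the cosh-distance. At [Q] the
    latter exceeds its value at [g p] by [ln (A - B tanh (x_i - p))], and the
    sum of these is positive by strict concavity of [ln]. When all the roots
    coincide there is no strictness off the half-plane, but then the balance
    point is the common root, as the convention requires ([julia_zeroE]).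

    Balance points [p] and [q] for [tanh] and [sinh] exist by the intermediate
    value theorem. So both zeros equal [P] exactly when one [p] with
    [g p = P] balances both functions, and an elementary argument on four real
    numbers (lemma [sinh_tanh_cancel]) shows that the [x_i - p] then cancel in
    pairs, which says that [P] is the midpoint of two pairs of roots.
    Conversely, cancellation in pairs balances both functions, as they are
    odd. *)

(** * Hyperbolic functions *)

Definition sinh {R : realType} (x : R) : R := (expR x - expR (- x)) / 2.

Definition tanh {R : realType} (x : R) : R := sinh x / cosh x.

Lemma coshN {R : realType} (x : R) : cosh (- x) = cosh x.
Proof. by rewrite /cosh opprK addrC. Qed.

Lemma sinhN {R : realType} (x : R) : sinh (- x) = - sinh x.
Proof. by rewrite /sinh opprK -mulNr opprB. Qed.

Lemma tanhN {R : realType} (x : R) : tanh (- x) = - tanh x.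
Proof. by rewrite /tanh sinhN coshN mulNr. Qed.

Lemma cosh0 {R : realType} : cosh (0 : R) = 1.
Proof. by rewrite /cosh oppr0 expR0; field. Qed.

Lemma sinh0 {R : realType} : sinh (0 : R) = 0.
Proof. by rewrite /sinh oppr0 expR0 subrr mul0r. Qed.

Lemma coshD {R : realType} (x y : R) :
  cosh (x + y) = cosh x * cosh y + sinh x * sinh y.
Proof. by rewrite /cosh /sinh opprD !expRD; field. Qed.

Lemma sinhD {R : realType} (x y : R) :
  sinh (x + y) = sinh x * cosh y + cosh x * sinh y.
Proof. by rewrite /cosh /sinh opprD !expRD; field. Qed.

Lemma cosh_gt0 {R : realType} (x : R) : 0 < cosh x.
Proof. by rewrite divr_gt0 ?addr_gt0 ?expR_gt0. Qed.

Lemma cosh2_sinh2 {R : realType} (x : R) : cosh x ^+ 2 - sinh x ^+ 2 = 1.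
Proof.
have := expRxMexpNx_1 x; rewrite /cosh /sinh => e.
by rewrite -[RHS]e; field.
Qed.

Lemma cosh_ge1 {R : realType} (x : R) : 1 <= cosh x.
Proof. by have := cosh2_sinh2 x; have := cosh_gt0 x; nra. Qed.

Lemma sinh_eq0 {R : realType} (x : R) : (sinh x == 0) = (x == 0).
Proof.
by rewrite mulf_eq0 invr_eq0 (gt_eqF (ltr0n R 2)) orbF subr_eq0
  (inj_eq (@expR_inj R)) -addr_eq0 -mulr2n mulrn_eq0.
Qed.

Lemma sinh_inj {R : realType} : injective (@sinh R).
Proof.
move=> x y e; apply/eqP; rewrite -subr_eq0 -sinh_eq0 sinhD sinhN coshN e.
have : cosh x ^+ 2 = cosh y ^+ 2.
  by move: (cosh2_sinh2 x) (cosh2_sinh2 y); rewrite e; lra.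
move/eqP; rewrite eqf_sqr => /orP[/eqP ->|/eqP ec]; first by apply/eqP; ring.
by have := cosh_gt0 x; have := cosh_gt0 y; lra.
Qed.

Lemma cosh_inj_norm {R : realType} (x y : R) :
  cosh x = cosh y -> x = y \/ x = - y.
Proof.
move=> e; have : sinh x ^+ 2 = sinh y ^+ 2.
  by move: (cosh2_sinh2 x) (cosh2_sinh2 y); rewrite e; lra.
move/eqP; rewrite eqf_sqr -sinhN.
by case/orP => /eqP /sinh_inj; [left|right].
Qed.

Lemma cosh_eq1 {R : realType} (x : R) : cosh x = 1 -> x = 0.
Proof. by rewrite -cosh0 => /cosh_inj_norm; rewrite oppr0; case. Qed.

Lemma tanh_bounds {R : realType} (x : R) : -1 < tanh x < 1.
Proof.
rewrite /tanh ltr_pdivlMr ?cosh_gt0// ltr_pdivrMr ?cosh_gt0//.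
by have := cosh2_sinh2 x; have := cosh_gt0 x; nra.
Qed.

Lemma cosh_norm {R : realType} (x : R) : cosh `|x| = cosh x.
Proof. by case: (ger0P x) => // _; rewrite coshN. Qed.

Lemma continuous_expRN {R : realType} : continuous (fun x : R => expR (- x)).
Proof.
move=> x; apply: continuous_comp; last exact: continuous_expR.
exact: opp_continuous.
Qed.

Lemma continuous_sinh {R : realType} : continuous (@sinh R).
Proof.
move=> x; rewrite /continuous_at /sinh; apply: cvgM; last exact: cvg_cst.
by apply: cvgB; [exact: continuous_expR|exact: continuous_expRN].
Qed.

Lemma continuous_cosh {R : realType} : continuous (@cosh R).
Proof.
move=> x; rewrite /continuous_at /cosh; apply: cvgM; last exact: cvg_cst.
by apply: cvgD; [exact: continuous_expR|exact: continuous_expRN].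
Qed.

Lemma continuous_tanh {R : realType} : continuous (@tanh R).
Proof.
move=> x; rewrite /continuous_at /tanh.
apply: cvgM; first exact: continuous_sinh.
by apply: cvgV; [rewrite gt_eqF ?cosh_gt0|exact: continuous_cosh].
Qed.

Lemma sinh_ge0 {R : realType} (x : R) : 0 <= x -> 0 <= sinh x.
Proof. by move=> x0; rewrite divr_ge0// subr_ge0 ler_expR; lra. Qed.

Lemma tanh_ge0 {R : realType} (x : R) : 0 <= x -> 0 <= tanh x.
Proof. by move=> /sinh_ge0 x0; rewrite divr_ge0// ltW ?cosh_gt0. Qed.

(** The intermediate value theorem applies on [[- M, M]] with [M] the sum of the
    absolute values: all the terms are nonnegative at [- M] and nonpositive at
    [M]. *)
Lemma odd_balance {R : realType} (phi : R -> R) (s : seq R) :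
  continuous phi -> (forall x, phi (- x) = - phi x) ->
  (forall x, 0 <= x -> 0 <= phi x) ->
  exists p, \sum_(x <- s) phi (x - p) = 0.
Proof.
move=> phic phiN phi0; pose f p := \sum_(x <- s) phi (x - p).
have fc : continuous f.
  move=> p; rewrite /f; elim: (s) => [|x r IH].
    by under eq_fun do rewrite big_nil; exact: cst_continuous.
  under eq_fun do rewrite big_cons.
  apply: continuousD => //; apply: continuous_comp; last exact: phic.
  by apply: continuousB; [exact: cst_continuous|exact: cvg_id].
pose M := \sum_(x <- s) `|x|.
have M0 : 0 <= M by exact: sumr_ge0.
have sM x : x \in s -> `|x| <= M.
  by move=> xs; rewrite /M (big_rem x)//= lerDl sumr_ge0.
have fM : f M <= 0 <= f (- M).
  rewrite -oppr_ge0 /f -sumrN [X in 0 <= X]big_seq [X in _ && (0 <= X)]big_seq.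
  apply/andP; split; apply: sumr_ge0 => x xs;
    have := sM _ xs; rewrite ler_norml.
    by rewrite -phiN opprB => /andP[_ xM]; rewrite phi0// subr_ge0.
  by rewrite opprK => /andP[xM _]; rewrite phi0// -lerBlDr sub0r.
have [|||p _ fp] := @IVT R f (- M) M 0; last by exists p.
- by rewrite ge0_cp.
- exact: continuous_subspaceT.
- by case/andP: fM => fM fNM; rewrite ge_min le_max fM fNM orbT.
Qed.

Lemma half_sum_diff {R : realType} (a b : R) :
  exists m h : R, a = m + h /\ b = m - h.
Proof. by exists ((a + b) / 2), ((a - b) / 2); split; field. Qed.

(** * Four real numbers with vanishing sums of sinh and tanh *)

(** The difference of the two sides is [X - Y] times the polynomial [G] below,
    which is positive as soon as [X <= K]. *)
Lemma rational_profile_inj {R : realType} (X Y K : R) :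
  0 < X -> 0 < Y -> X <= K ->
  X ^+ 3 * (1 + X) * (Y ^+ 2 + K) ^+ 2 = Y ^+ 3 * (1 + Y) * (X ^+ 2 + K) ^+ 2 ->
  X = Y.
Proof.
move=> X0 Y0 XK e.
set G := X ^+ 2 * Y ^+ 3 * (K - X) + K * X ^+ 2 * Y ^+ 2 * (2 + 2 * X + Y)
  + K ^+ 2 * (X ^+ 2 + X * Y + Y ^+ 2 + (X + Y) * (X ^+ 2 + Y ^+ 2)).
have K0 : 0 < K by apply: lt_le_trans XK.
have G0 : 0 < G.
  rewrite /G -addrA ltr_wpDl//.
    by rewrite !mulr_ge0 ?exprn_ge0 ?subr_ge0// ltW.
  by rewrite !(addr_gt0, mulr_gt0, exprn_gt0).
have : (X - Y) * G = 0.
  by move/eqP: e; rewrite -subr_eq0 => /eqP <-; rewrite /G; ring.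
by move/eqP; rewrite mulf_eq0 (gt_eqF G0) orbF subr_eq0 => /eqP.
Qed.

Lemma tanh_sum {R : realType} (m h : R) :
  tanh (m + h) + tanh (m - h)
  = 2 * (sinh m * cosh m / (sinh m ^+ 2 + cosh h ^+ 2)).
Proof.
have e : cosh (m + h) * cosh (m - h) = sinh m ^+ 2 + cosh h ^+ 2.
  rewrite !coshD coshN sinhN.
  by have := cosh2_sinh2 m; have := cosh2_sinh2 h; nra.
rewrite -e /tanh addf_div ?gt_eqF ?cosh_gt0// mulrA; congr (_ / _).
rewrite !sinhD !coshD coshN sinhN.
transitivity (2 * (sinh m * cosh m) * (cosh h ^+ 2 - sinh h ^+ 2)); first ring.
by rewrite cosh2_sinh2 mulr1.
Qed.

(** For [X = S ^ 2], [Y = T ^ 2] and [K = (S u) ^ 2 = (T v) ^ 2], eliminating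
    [u] and [v] from the square of the last equation gives the equation of
    [rational_profile_inj], and [X <= K] because [u >= 1]. *)
Lemma profile_sqr {R : realType} (S c u T d v : R) :
  S != 0 -> T != 0 -> 1 <= u -> 0 < v ->
  c ^+ 2 = 1 + S ^+ 2 -> d ^+ 2 = 1 + T ^+ 2 ->
  S * u = - (T * v) ->
  S * c / (S ^+ 2 + u ^+ 2) = - (T * d / (T ^+ 2 + v ^+ 2)) ->
  S ^+ 2 = T ^+ 2.
Proof.
move=> S0 T0 u1 v0 cS dT su tu.
have X0 : 0 < S ^+ 2 by rewrite exprn_even_gt0.
have Y0 : 0 < T ^+ 2 by rewrite exprn_even_gt0.
have eK : (T * v) ^+ 2 = (S * u) ^+ 2 by rewrite su sqrrN.
apply: (@rational_profile_inj R _ _ ((S * u) ^+ 2)) => //.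
  by rewrite exprMn ler_peMr ?exprn_ege1// ltW.
have d1 : S ^+ 2 + u ^+ 2 != 0 by rewrite gt_eqF// ltr_wpDr// sqr_ge0.
have d2 : T ^+ 2 + v ^+ 2 != 0 by rewrite gt_eqF// ltr_wpDr// sqr_ge0.
move/eqP: tu; rewrite -mulNr eqr_div// => /eqP/(congr1 (fun z => z ^+ 2)) {}tu.
rewrite exprMn (exprMn _ S) mulNr sqrrN !exprMn cS dT in tu.
have -> : (T ^+ 2) ^+ 2 + (S * u) ^+ 2 = T ^+ 2 * (T ^+ 2 + v ^+ 2).
  by rewrite -eK; ring.
transitivity (S ^+ 2 * (1 + S ^+ 2) * (T ^+ 2 + v ^+ 2) ^+ 2
   * (S ^+ 2 * T ^+ 2) ^+ 2); first ring.
by rewrite tu; ring.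
Qed.

(** Write the numbers as [m + h], [m - h], [n + k], [n - k]. The first sum says
    [sinh m cosh h = - sinh n cosh k]. If [m = 0] then [n = 0]. Otherwise, by
    [profile_sqr], [sinh m] and [sinh n] have the same square, so [m = - n],
    hence [cosh h = cosh k] and [h] is [k] or [- k]. *)
Lemma sinh_tanh_cancel {R : realType} (a b c d : R) :
  sinh a + sinh b + sinh c + sinh d = 0 ->
  tanh a + tanh b + tanh c + tanh d = 0 ->
  [\/ a + b = 0 /\ c + d = 0, a + c = 0 /\ b + d = 0 | a + d = 0 /\ b + c = 0].
Proof.
have [m [h [-> ->]]] := half_sum_diff a b.
have [n [k [-> ->]]] := half_sum_diff c d => sh th.
have su : sinh m * cosh h = - (sinh n * cosh k).
  by move: sh; rewrite !sinhD !coshN !sinhN; lra.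
have tu : sinh m * cosh m / (sinh m ^+ 2 + cosh h ^+ 2)
        = - (sinh n * cosh n / (sinh n ^+ 2 + cosh k ^+ 2)).
  apply/eqP; rewrite -addr_eq0 -(mulrI_eq0 _ (@mulfI _ 2 _)) ?pnatr_eq0//.
  by rewrite mulrDr -(tanh_sum m h) -(tanh_sum n k) addrA th.
have [m0|m_neq0] := eqVneq m 0.
  have : n == 0.
    rewrite -sinh_eq0; move: su; rewrite m0 sinh0 mul0r => /esym/eqP.
    by rewrite oppr_eq0 mulf_eq0 (gt_eqF (cosh_gt0 k)) orbF.
  by rewrite m0 => /eqP ->; constructor 1; split; ring.
have n_neq0 : n != 0.
  apply: contra_neq m_neq0 => n0; apply/eqP; rewrite -sinh_eq0.
  move: su; rewrite n0 sinh0 mul0r oppr0 => /eqP.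
  by rewrite mulf_eq0 (gt_eqF (cosh_gt0 h)) orbF.
have e : sinh m ^+ 2 = sinh n ^+ 2.
  apply: (profile_sqr _ _ (cosh_ge1 h) (cosh_gt0 k) _ _ su tu);
    rewrite ?sinh_eq0//.
    by have := cosh2_sinh2 m; lra.
  by have := cosh2_sinh2 n; lra.
have {}e : m = - n.
  move/eqP: e; rewrite eqf_sqr => /orP[/eqP e|/eqP]; last first.
    by rewrite -sinhN => /sinh_inj.
  have : sinh n * (cosh h + cosh k) = 0 by rewrite mulrDr -{1}e su; ring.
  move/eqP; rewrite mulf_eq0 sinh_eq0 (negPf n_neq0) /= gt_eqF//.
  by rewrite addr_gt0 ?cosh_gt0.
have : cosh h = cosh k.
  move: su; rewrite e sinhN mulNr => /oppr_inj; apply: mulfI.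
  by rewrite sinh_eq0.
rewrite e => /cosh_inj_norm[->|->]; first by constructor 3; split; ring.
by constructor 2; split; ring.
Qed.

(** * The hyperbolic plane inside Minkowski space *)

Lemma cosh_arcosh {R : realType} (u : R) : 1 <= u -> cosh (arcosh u) = u.
Proof.
move=> u1; rewrite /cosh /arcosh; set r := Num.sqrt _.
have r2 : r ^+ 2 = u ^+ 2 - 1 by rewrite sqr_sqrtr// subr_ge0 exprn_ege1.
have w0 : 0 < u + r by rewrite ltr_wpDr ?sqrtr_ge0//; lra.
rewrite expRN lnK ?posrE//.
have -> : (u + r)^-1 = u - r.
  apply: (mulfI (lt0r_neq0 w0)); rewrite divff ?gt_eqF//.
  by rewrite mulrC -subr_sqr r2 opprB addrC subrK.
by field.
Qed.

Definition cosh_dist {R : realType} (P Q : H2 R) : R :=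
  1 + ((complex.Re P - complex.Re Q) ^+ 2 + (complex.Im P - complex.Im Q) ^+ 2)
      / (2 * complex.Im P * complex.Im Q).

Lemma cosh_dist_ge1 {R : realType} (P Q : H2 R) : 1 <= cosh_dist P Q.
Proof.
rewrite /cosh_dist lerDl divr_ge0 ?addr_ge0 ?sqr_ge0//.
by rewrite !mulr_ge0// ltW ?H2P.
Qed.

Lemma cosh_dist_gt0 {R : realType} (P Q : H2 R) : 0 < cosh_dist P Q.
Proof. exact: lt_le_trans (cosh_dist_ge1 P Q). Qed.

Lemma cosh_dist_H2 {R : realType} (P Q : H2 R) :
  cosh (dist_H2 P Q) = cosh_dist P Q.
Proof. by rewrite cosh_arcosh ?cosh_dist_ge1. Qed.

Lemma H2_inj {R : realType} (P Q : H2 R) :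
  complex.Re P = complex.Re Q -> complex.Im P = complex.Im Q -> P = Q.
Proof.
move=> eRe eIm; apply: val_inj => /=.
by case: P Q eRe eIm => [[x y] ?] [[u v] ?] /= -> ->.
Qed.

Lemma cosh_dist_eq1 {R : realType} (P Q : H2 R) : cosh_dist P Q = 1 -> P = Q.
Proof.
move/(congr1 (fun z => z - 1)); rewrite /cosh_dist addrC addKr subrr => /eqP.
have d0 := mulr_gt0 (mulr_gt0 (ltr0Sn R 1) (H2P P)) (H2P Q).
rewrite mulf_eq0 invr_eq0 (gt_eqF d0).
rewrite orbF paddr_eq0 ?sqr_ge0// !sqrf_eq0 !subr_eq0 => /andP[/eqP ? /eqP ?].
exact: H2_inj.
Qed.

(** A triple [(a, b, c)] stands for the binary quadratic form
    [a X ^ 2 - 2 b X Z + c Z ^ 2], and [pol] is the polar form of the determinant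
    [a c - b ^ 2]; [hvec P] is the positive definite form of determinant [1] that
    has [P] as a root. *)
Definition minkowski (R : realType) : lmodType R := (R^o * R^o * R^o)%type.

Definition pol {R : realType} (v w : minkowski R) : R :=
  ((v.1.1 : R) * w.2 + (v.2 : R) * w.1.1) / 2 - (v.1.2 : R) * w.1.2.

Definition hvec {R : realType} (P : H2 R) : minkowski R :=
  let x := complex.Re P in let y := complex.Im P in
  (y^-1, x / y, (x ^+ 2 + y ^+ 2) / y).

Lemma polC {R : realType} (v w : minkowski R) : pol v w = pol w v.
Proof. by rewrite /pol; ring. Qed.

Lemma polDr {R : realType} (u v w : minkowski R) :
  pol u (v + w) = pol u v + pol u w.
Proof. by rewrite /pol /=; ring. Qed.

Lemma polZr {R : realType} k (u v : minkowski R) : pol u (k *: v) = k * pol u v.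
Proof. by rewrite /pol /= /GRing.scale /=; ring. Qed.

Lemma polDl {R : realType} (u v w : minkowski R) :
  pol (v + w) u = pol v u + pol w u.
Proof. by rewrite polC polDr !(polC u). Qed.

Lemma polZl {R : realType} k (u v : minkowski R) : pol (k *: v) u = k * pol v u.
Proof. by rewrite polC polZr polC. Qed.

Lemma pol_hvec {R : realType} (P Q : H2 R) :
  pol (hvec P) (hvec Q) = cosh_dist P Q.
Proof.
rewrite /pol /cosh_dist /=; field.
by rewrite !gt_eqF ?H2P.
Qed.

Lemma pol_hvec_diag {R : realType} (P : H2 R) : pol (hvec P) (hvec P) = 1.
Proof.
by rewrite pol_hvec /cosh_dist !subrr expr0n /= addr0 mul0r addr0.
Qed.

(** The form [pol] has signature (1, 2), so it is negative definite on the
    orthogonal of a vector of square [1]. *)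
Lemma pol_orth {R : realType} (u v : minkowski R) :
  pol u u = 1 -> pol u v = 0 -> pol v v <= 0 /\ (pol v v = 0 -> v = 0).
Proof.
case: u v => [[a b] c] [[x y] z]; rewrite /pol /= => uu uv.
have ac : a * c = 1 + b ^+ 2 by nra.
have a0 : a != 0.
  by apply: contra_eq_neq ac => ->; rewrite mul0r lt_eqF// ltr_wpDr ?sqr_ge0.
have ez : z = (2 * b * y - c * x) / a.
  by apply: (mulIf a0); rewrite divfK//; lra.
(* Solving for [z], the square of [v] becomes minus a sum of squares. *)
have e : (x * z + z * x) / 2 - y * y
    = - ((a * y - b * x) ^+ 2 + x ^+ 2) / a ^+ 2.
  have {}ez : z = (2 * b * y * a - (1 + b ^+ 2) * x) / a ^+ 2.
    by rewrite -ac ez; field.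
  by rewrite ez; field.
rewrite e; split.
  by rewrite mulNr oppr_le0 divr_ge0 ?addr_ge0 ?sqr_ge0.
move/eqP; rewrite mulf_eq0 oppr_eq0 invr_eq0 sqrf_eq0 (negPf a0) orbF.
rewrite paddr_eq0 ?sqr_ge0// !sqrf_eq0 => /andP[+ /eqP x0].
rewrite ez x0 mulr0 subr0 mulf_eq0 (negPf a0) /= => /eqP ->.
by rewrite !mulr0 subr0 mul0r.
Qed.

(** * Geodesics and midpoints *)

Definition isometric {R : realType} (g : R -> H2 R) :=
  forall s t, dist_H2 (g s) (g t) = `|s - t|.

Lemma cosh_dist_isometric {R : realType} (g : R -> H2 R) (s t : R) :
  isometric g -> cosh_dist (g s) (g t) = cosh (s - t).
Proof. by move=> gP; rewrite -cosh_dist_H2 gP cosh_norm. Qed.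

Lemma isometric_inj {R : realType} (g : R -> H2 R) : isometric g -> injective g.
Proof.
move=> gP s t e; have := cosh_dist_isometric s t gP.
rewrite e -pol_hvec pol_hvec_diag => /esym/cosh_eq1/eqP.
by rewrite subr_eq0 => /eqP.
Qed.

(** With [u] the vector of [g p], [e] is the unit tangent vector obtained by
    orthonormalizing [g (p + 1)] against [u]. The error vector
    [g (p + s) - cosh s u - sinh s e] is orthogonal to [u] and isotropic, since
    all products involved are known from the distances; so it vanishes. *)
Lemma isometric_frame {R : realType} (g : R -> H2 R) (p : R) : isometric g ->
  exists e : minkowski R, [/\ pol (hvec (g p)) e = 0, pol e e = -1
    & forall s, hvec (g (p + s)) = cosh s *: hvec (g p) + sinh s *: e].
Proof.
move=> gP; set u := hvec (g p).
have uu : pol u u = 1 by exact: pol_hvec_diag.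
have sh1 : sinh 1 != 0 :> R by rewrite sinh_eq0 oner_eq0.
have guE s : pol (hvec (g (p + s))) u = cosh s.
  by rewrite pol_hvec cosh_dist_isometric// addrC addKr.
have ggE s t : pol (hvec (g (p + s))) (hvec (g (p + t))) = cosh (s - t).
  by rewrite pol_hvec cosh_dist_isometric// opprD addrACA subrr add0r.
pose e := (sinh 1)^-1 *: (hvec (g (p + 1)) + (- cosh 1) *: u).
have ue : pol u e = 0.
  by rewrite /e polZr polDr polZr uu polC guE mulr1 subrr mulr0.
have ge s : pol (hvec (g (p + s))) e = - sinh s.
  rewrite /e polZr polDr polZr guE ggE coshD coshN sinhN.
  by apply: (mulfI sh1); rewrite mulrA divff// mul1r; ring.
have ee : pol e e = -1.
  rewrite {1}/e polZl polDl polZl ue ge mulr0 addr0.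
  by rewrite mulrN mulVf.
clearbody e; exists e; split=> // s.
apply/eqP; rewrite -subr_eq0 opprD addrA.
rewrite -(scaleNr (cosh s)) -(scaleNr (sinh s)); apply/eqP.
set v := _ + _.
have uv : pol u v = 0.
  by rewrite /v !polDr !polZr uu ue polC guE; ring.
apply: (pol_orth uu uv).2.
rewrite {1}/v !polDl !polZl uv /v !polDr !polZr ggE !ge !(polC e) !ge ee ue guE.
rewrite subrr cosh0; have := cosh2_sinh2 s; lra.
Qed.

(** The bound on [B] says that the component of [Q] orthogonal to the plane of
    the geodesic has nonpositive square. *)
Lemma cosh_dist_along {R : realType} (g : R -> H2 R) (Q : H2 R) (p : R) :
  isometric g ->
  exists B : R, 1 + B ^+ 2 <= cosh_dist Q (g p) ^+ 2 /\
    forall s, cosh_dist Q (g (p + s)) = cosh_dist Q (g p) * cosh s - B * sinh s.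
Proof.
move=> /(isometric_frame p)[e [ue ee gE]].
exists (- pol (hvec Q) e); split=> [|s]; last first.
  by rewrite -!pol_hvec gE polDr !polZr; ring.
rewrite -pol_hvec.
set u := hvec (g p) in ue *; set q := hvec Q; set b := pol q e.
have uu : pol u u = 1 := pol_hvec_diag _.
have qq : pol q q = 1 := pol_hvec_diag _.
pose n := q + (- pol q u) *: u + b *: e.
have un : pol u n = 0.
  by rewrite /n !polDr !polZr uu ue polC; ring.
have [+ _] := pol_orth uu un.
rewrite {1}/n !polDl !polZl un /n !polDr !polZr qq !(polC e) ue ee -/b sqrrN.
lra.
Qed.

(** A midpoint of two points of the geodesic is not assumed to lie on it: with
    [m] the middle parameter and [h] the half-distance, the two conditions
    [A cosh h - B sinh h = cosh h = A cosh h + B sinh h] force [A = 1]. *)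
Lemma midpoint_isometric {R : realType} (g : R -> H2 R) (s t : R) (P : H2 R) :
  isometric g -> is_midpoint (g s) (g t) P <-> P = g ((s + t) / 2).
Proof.
move=> gP; have [m [h [-> ->]]] := half_sum_diff s t.
rewrite /is_midpoint !gP.
have -> : (m + h + (m - h)) / 2 = m by field.
have -> : m + h - (m - h) = 2 * h by ring.
rewrite normrM ger0_norm// [_ * _ / _]mulrAC divff// mul1r.
split=> [[eP eP']|->]; last first.
  by rewrite !gP; split; congr `|_|; ring.
have [B [_ PE]] := cosh_dist_along P m gP.
apply: cosh_dist_eq1.
have e1 : cosh_dist P (g (m + h)) = cosh h.
  by rewrite -cosh_norm -eP cosh_dist_H2 -!pol_hvec polC.
have e2 : cosh_dist P (g (m - h)) = cosh h.
  by rewrite -cosh_norm -eP' cosh_dist_H2.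
apply: (mulIf (lt0r_neq0 (cosh_gt0 h))); rewrite mul1r.
move: e1 e2; rewrite !PE coshN sinhN; lra.
Qed.

(** * Minimizers in the hyperbolic plane *)

Lemma xget_unique_minimizer {R : realType} (T : choiceType) (x0 : T)
    (f : T -> R) (w : T) :
  unique_minimizers f w -> xget x0 (unique_minimizers f) = w.
Proof.
move=> fw; apply: xget_unique => // v fv.
apply/eqP/negPn/negP => /eqP vw.
by have := lt_trans (fw _ vw) (fv _ (nesym vw)); rewrite ltxx.
Qed.

Lemma ltr_sum_exists {R : realType} (I : eqType) (r : seq I) (F G : I -> R) i :
  (forall j, F j <= G j) -> i \in r -> F i < G i ->
  \sum_(j <- r) F j < \sum_(j <- r) G j.
Proof.
move=> FG ir FGi; rewrite (big_rem i)//= [ltRHS](big_rem i)//=.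
by rewrite ltr_leD// ler_sum.
Qed.

(** By [cosh_dist_along] the function is [cosh_dist Q (g p)] times a positive
    constant. *)
Lemma hyperbolic_minimizer {R : realType} (g : R -> H2 R) (s : seq R) (p : R) :
  isometric g -> s != [::] -> \sum_(x <- s) sinh (x - p) = 0 ->
  unique_minimizers
    (fun Q => \sum_(a <- map g s) cosh (dist_H2 Q a)) (g p).
Proof.
move=> gP s0 sh0 Q /eqP Qp.
have sumE P : \sum_(a <- map g s) cosh (dist_H2 P a)
    = cosh_dist P (g p) * \sum_(x <- s) cosh (x - p).
  have [B [_ PE]] := cosh_dist_along P p gP.
  transitivity (cosh_dist P (g p) * \sum_(x <- s) cosh (x - p)
      - B * \sum_(x <- s) sinh (x - p)); last by rewrite sh0 mulr0 subr0.
  rewrite big_map !mulr_sumr -sumrB; apply: eq_bigr => x _.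
  by rewrite cosh_dist_H2 -{1}(subrK p x) [_ + p]addrC PE.
rewrite !sumE cosh_dist_isometric// subrr cosh0 ltr_pM2r.
  rewrite lt_neqAle cosh_dist_ge1 andbT; apply: contra_neq Qp => e.
  exact: cosh_dist_eq1.
case: s s0 {sh0 sumE} => // x s _; rewrite big_cons ltr_pwDl ?cosh_gt0//.
by apply: sumr_ge0 => y _; rewrite ltW ?cosh_gt0.
Qed.

Lemma ln_lt_subr1 {R : realType} (x : R) : 0 < x -> x != 1 -> ln x < x - 1.
Proof.
move=> x0 x1; have xK : expR (ln x) = x by rewrite lnK ?posrE.
by rewrite ltrBrDl -[ltRHS]xK expR_gt1Dx// ln_eq0.
Qed.

Lemma ln_le_subr1 {R : realType} (x : R) : 0 < x -> ln x <= x - 1.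
Proof.
move=> x0; have [->|x1] := eqVneq x 1; first by rewrite ln1 subrr.
exact/ltW/ln_lt_subr1.
Qed.

(** Strict concavity of [ln], with the weights that occur in [sum_ln_gt0]. *)
Lemma ln_jensen {R : realType} (u w t : R) : 0 < u -> 0 < w -> -1 < t < 1 ->
  let z := (1 + t) / 2 * u + (1 - t) / 2 * w in
  (1 + t) / 2 * ln u + (1 - t) / 2 * ln w <= ln z /\
  (u != w -> (1 + t) / 2 * ln u + (1 - t) / 2 * ln w < ln z).
Proof.
move=> u0 w0 /andP[t1 t2] z.
have k0 : 0 < (1 + t) / 2 by lra.
have l0 : 0 < (1 - t) / 2 by lra.
have z0 : 0 < z by rewrite addr_gt0// mulr_gt0.
have zE : (1 + t) / 2 * (u / z - 1) + (1 - t) / 2 * (w / z - 1) = 0.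
  transitivity (((1 + t) / 2 * u + (1 - t) / 2 * w) / z - 1).
    by move: z z0 => z z0; field; rewrite gt_eqF.
  by rewrite -/z divff ?subrr ?gt_eqF.
have lnu := ln_le_subr1 (divr_gt0 u0 z0).
have lnw := ln_le_subr1 (divr_gt0 w0 z0).
rewrite !ln_div ?posrE// in lnu lnw.
split=> [|uw]; first nra.
have /ln_lt_subr1 : u / z != 1.
  apply: contra_neq uw => /(congr1 (fun x => x * z)).
  by rewrite divfK ?gt_eqF// mul1r /z => uE; apply: (mulfI (lt0r_neq0 l0)); lra.
by rewrite divr_gt0// ln_div ?posrE// => /(_ isT); nra.
Qed.

(** [A - B t] is the mean of [A - B] and [A + B] with weights [(1 + t) / 2] and
    [(1 - t) / 2]. Since the [t x] sum to [0], Jensen's inequality bounds the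
    sum below by half the number of terms times [ln (A ^ 2 - B ^ 2) >= 0]. It is
    strict unless [B = 0], in which case each term is [ln A > 0]. *)
Lemma sum_ln_gt0 {R : realType} (A B : R) (s : seq R) (t : R -> R) :
  1 < A -> 1 + B ^+ 2 <= A ^+ 2 -> s != [::] ->
  (forall x, -1 < t x < 1) -> \sum_(x <- s) t x = 0 ->
  0 < \sum_(x <- s) ln (A - B * t x).
Proof.
move=> A1 AB s0 t1 t0.
have AB1 : 0 < A - B by nra.
have AB2 : 0 < A + B by nra.
pose F x := (1 + t x) / 2 * ln (A - B) + (1 - t x) / 2 * ln (A + B).
have Fsum : \sum_(x <- s) F x = (size s)%:R / 2 * ln (A ^+ 2 - B ^+ 2).
  rewrite subr_sqr lnM ?posrE//.
  transitivity (\sum_(x <- s) ((ln (A - B) + ln (A + B)) / 2)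
     + (ln (A - B) - ln (A + B)) / 2 * \sum_(x <- s) t x).
    by rewrite mulr_sumr -big_split/=; apply: eq_bigr => x _; rewrite /F; field.
  rewrite t0 mulr0 addr0 big_const_seq count_predT iter_addr_0.
  by rewrite -mulr_natl; field.
have FE x : A - B * t x = (1 + t x) / 2 * (A - B) + (1 - t x) / 2 * (A + B).
  by field.
have F0 : 0 <= \sum_(x <- s) F x.
  by rewrite Fsum mulr_ge0 ?divr_ge0// ln_ge0//; lra.
have [B0|B0] := eqVneq B 0.
  rewrite B0; under eq_bigr do rewrite mul0r subr0.
  rewrite big_const_seq count_predT iter_addr_0 pmulrn_lgt0 ?ln_gt0//.
  by rewrite lt0n size_eq0.
apply: le_lt_trans F0 _.
case: s s0 {t0 Fsum} => // x s _; apply: (@ltr_sum_exists _ _ _ _ _ x).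
- by move=> y; rewrite FE; exact: (ln_jensen AB1 AB2 (t1 y)).1.
- exact: mem_head.
- rewrite FE; apply: (ln_jensen AB1 AB2 (t1 x)).2.
  by apply: contra_neq B0; lra.
Qed.

(** The cosh-distance to [g x] is [cosh (x - p)] from [g p] and
    [cosh (x - p) (A - B tanh (x - p))] from [Q]. *)
Lemma sum_ln_cosh_dist_lt {R : realType} (g : R -> H2 R) (s : seq R) (p : R)
    (Q : H2 R) :
  isometric g -> s != [::] -> \sum_(x <- s) tanh (x - p) = 0 -> Q <> g p ->
  \sum_(a <- map g s) ln (cosh_dist (g p) a)
  < \sum_(a <- map g s) ln (cosh_dist Q a).
Proof.
move=> gP s0 th0 Qp.
have [B [AB QE]] := cosh_dist_along Q p gP.
have A1 : 1 < cosh_dist Q (g p).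
  rewrite lt_neqAle cosh_dist_ge1 andbT; apply/eqP => e.
  by apply: Qp; apply: cosh_dist_eq1.
rewrite -subr_gt0 !big_map -sumrB.
rewrite (eq_bigr (fun x => ln (cosh_dist Q (g p) - B * tanh (x - p)))).
  by apply: sum_ln_gt0 => // x; exact: tanh_bounds.
move=> x _; have c0 := cosh_gt0 (x - p).
rewrite -ln_div ?posrE ?cosh_dist_gt0// cosh_dist_isometric// -opprB coshN.
congr ln; rewrite -{1}(subrK p x) [_ + p]addrC QE /tanh.
by field; rewrite gt_eqF.
Qed.

(** * Julia's function on hyperbolic space *)

Lemma shadow_subproof {R : realType} (w : H3 R) :
  0 < complex.Im (Complex (complex.Re (val w).1)
        (Num.sqrt (complex.Im (val w).1 ^+ 2 + (val w).2 ^+ 2))).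
Proof. by rewrite /= sqrtr_gt0 ltr_wpDl ?sqr_ge0// exprn_gt0// H3P. Qed.

(** The orthogonal projection of the hyperbolic space onto the plane: it rotates
    the pair (imaginary part, height) onto the height axis. *)
Definition shadow {R : realType} (w : H3 R) : H2 R := MkH2 (shadow_subproof w).

Lemma H3_real {R : realType} (w : H3 R) :
  complex.Im (val w).1 = 0 -> w = H2_to_H3 (shadow w).
Proof.
move=> w0; apply: val_inj; move: w0 (H3P w) => /=.
case: w => [[[x y] t] t0] /= -> _.
by rewrite expr0n add0r sqrtr_sqr ger0_norm// ltW.
Qed.

Lemma H2_to_H3_inj {R : realType} : injective (@H2_to_H3 R).
Proof.
by move=> P Q /(congr1 val)[eRe eIm]; apply: H2_inj.
Qed.

Lemma cosh_distE {R : realType} (P Q : H2 R) :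
  (complex.Re P - complex.Re Q) ^+ 2 + complex.Im P ^+ 2 + complex.Im Q ^+ 2
  = 2 * complex.Im P * complex.Im Q * cosh_dist P Q.
Proof. by rewrite /cosh_dist; field; rewrite !gt_eqF ?H2P. Qed.

Lemma dist_H3_bdryE {R : realType} (w : H3 R) (b : R[i]) :
  dist_H3_bdry w b
  = ln (((complex.Re (val w).1 - complex.Re b) ^+ 2
         + (complex.Im (val w).1 - complex.Im b) ^+ 2 + (val w).2 ^+ 2)
        / (val w).2).
Proof. by case: w b => [[[x y] t] t0] [u v]. Qed.

(** The correction term measures how far [w] is from the plane; it is
    nonnegative, and vanishes only on the plane or when the shadow is [a]. *)
Lemma dist_H3_bdry_pair {R : realType} (w : H3 R) (a : H2 R) :
  let C := cosh_dist (shadow w) a in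
  dist_H3_bdry w a + dist_H3_bdry w (conjc a)
  = ln ((2 * complex.Im a * C) ^+ 2
        + (2 * complex.Im (val w).1 * complex.Im a / (val w).2) ^+ 2
          * (C ^+ 2 - 1)).
Proof.
move=> C; have := cosh_distE (shadow w) a; rewrite -/C; clearbody C.
have t0 := H3P w; have v0 := H2P a.
rewrite !dist_H3_bdryE /=.
have -> : complex.Re (conjc a) = complex.Re a by case: (val a).
have -> : complex.Im (conjc a) = - complex.Im a by case: (val a).
move: (complex.Re (val w).1) (complex.Im (val w).1) t0 v0 => x eta.
move: (val w).2 (complex.Re a) (complex.Im a) => t u v t0 v0.
set y := Num.sqrt _ => CE.
have y2 : y ^+ 2 = eta ^+ 2 + t ^+ 2 by rewrite sqr_sqrtr// addr_ge0 ?sqr_ge0.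
rewrite y2 in CE.
rewrite -lnM ?posrE; first congr ln.
- have -> : (x - u) ^+ 2 + (eta - v) ^+ 2 + t ^+ 2
      = 2 * y * v * C - 2 * eta * v by rewrite -CE; ring.
  have -> : (x - u) ^+ 2 + (eta - - v) ^+ 2 + t ^+ 2
      = 2 * y * v * C + 2 * eta * v by rewrite -CE; ring.
  transitivity (((2 * v * C) ^+ 2 * y ^+ 2 - (2 * eta * v) ^+ 2) / t ^+ 2).
    by field; rewrite gt_eqF.
  by rewrite y2; field; rewrite gt_eqF.
- by rewrite divr_gt0// ltr_wpDl ?exprn_gt0// addr_ge0 ?sqr_ge0.
- by rewrite divr_gt0// ltr_wpDl ?exprn_gt0// addr_ge0 ?sqr_ge0.
Qed.

Lemma sqr_cosh_dist_ge1 {R : realType} (P Q : H2 R) :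
  0 <= cosh_dist P Q ^+ 2 - 1.
Proof. by rewrite subr_ge0 exprn_ege1 ?cosh_dist_ge1. Qed.

Lemma dist_H3_bdry_ge {R : realType} (w : H3 R) (a : H2 R) :
  ln ((2 * complex.Im a * cosh_dist (shadow w) a) ^+ 2)
    <= dist_H3_bdry w a + dist_H3_bdry w (conjc a).
Proof.
have q0 : 0 < (2 * complex.Im a * cosh_dist (shadow w) a) ^+ 2.
  by rewrite exprn_gt0// !mulr_gt0 ?H2P ?cosh_dist_gt0.
have e0 : 0 <= (2 * complex.Im (val w).1 * complex.Im a / (val w).2) ^+ 2
               * (cosh_dist (shadow w) a ^+ 2 - 1).
  by rewrite mulr_ge0 ?sqr_ge0 ?sqr_cosh_dist_ge1.
rewrite dist_H3_bdry_pair ler_ln ?posrE ?ltr_wpDr//.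
by rewrite lerDl.
Qed.

Lemma dist_H3_bdry_gt {R : realType} (w : H3 R) (a : H2 R) :
  complex.Im (val w).1 != 0 -> shadow w != a ->
  ln ((2 * complex.Im a * cosh_dist (shadow w) a) ^+ 2)
    < dist_H3_bdry w a + dist_H3_bdry w (conjc a).
Proof.
move=> w0 wa.
have q0 : 0 < (2 * complex.Im a * cosh_dist (shadow w) a) ^+ 2.
  by rewrite exprn_gt0// !mulr_gt0 ?H2P ?cosh_dist_gt0.
have C1 : 1 < cosh_dist (shadow w) a.
  rewrite lt_neqAle cosh_dist_ge1 andbT; apply: contra_neq wa => e.
  exact: cosh_dist_eq1.
have e0 : 0 < (2 * complex.Im (val w).1 * complex.Im a / (val w).2) ^+ 2
               * (cosh_dist (shadow w) a ^+ 2 - 1).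
  rewrite mulr_gt0 ?subr_gt0 ?exprn_egt1// exprn_even_gt0//=.
  rewrite !mulf_neq0 ?invr_neq0//; rewrite gt_eqF ?H2P ?H3P//.
by rewrite dist_H3_bdry_pair ltr_ln ?posrE ?addr_gt0// ltrDl.
Qed.

Lemma dist_H3_bdry_H2 {R : realType} (P a : H2 R) :
  dist_H3_bdry (H2_to_H3 P) a + dist_H3_bdry (H2_to_H3 P) (conjc a)
  = ln ((2 * complex.Im a * cosh_dist P a) ^+ 2).
Proof.
rewrite dist_H3_bdry_pair.
have -> : shadow (H2_to_H3 P) = P by apply: H2_to_H3_inj; rewrite -H3_real.
by rewrite /= mulr0 !mul0r expr0n mul0r addr0.
Qed.

(** Replacing [w] by its shadow does not increase any term and, when [w] is off
    the plane, decreases the terms of the points other than the shadow; such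
    points exist because the points are not all equal. On the plane the function
    is, up to a constant, twice the sum of the [ln (cosh_dist Q a)]. *)
Lemma julia_minimizer {R : realType} (g : R -> H2 R) (s : seq R) (p : R) :
  isometric g -> (exists x y, [/\ x \in s, y \in s & x != y]) ->
  \sum_(x <- s) tanh (x - p) = 0 ->
  unique_minimizers
    (fun w => \sum_(a <- map g s)
                (dist_H3_bdry w (val a) + dist_H3_bdry w (conjc (val a))))
    (H2_to_H3 (g p)).
Proof.
move=> gP [x [y [xs ys xy]]] th0 w wp.
have s0 : s != [::] by case: (s) xs.
pose J Q :=
  \sum_(a <- map g s) ln ((2 * complex.Im (val a) * cosh_dist Q a) ^+ 2).
have JP : \sum_(a <- map g s) (dist_H3_bdry (H2_to_H3 (g p)) (val a)
     + dist_H3_bdry (H2_to_H3 (g p)) (conjc (val a))) = J (g p).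
  by apply: eq_bigr => a _; exact: dist_H3_bdry_H2.
have JE Q : J Q = \sum_(a <- map g s) ln (2 * complex.Im (val a)) *+ 2
    + (\sum_(a <- map g s) ln (cosh_dist Q a)) *+ 2.
  rewrite -sumrMnl -big_split; apply: eq_bigr => a _.
  have v0 : 0 < 2 * complex.Im (val a) by rewrite mulr_gt0 ?H2P.
  have C0 := cosh_dist_gt0 Q a.
  rewrite lnXn ?(mulr_gt0 v0 C0)//= -mulrnDl; congr (_ *+ 2).
  by rewrite lnM ?posrE.
have Jlt Q : Q <> g p -> J (g p) < J Q.
  by move=> Qp; rewrite !JE ltrD2l ltrMn2r/=; exact: sum_ln_cosh_dist_lt.
rewrite JP.
have [w0|w0] := eqVneq (complex.Im (val w).1) 0.
  have wE := H3_real w0.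
  apply: (lt_le_trans (Jlt (shadow w) _)).
    by move=> e; apply: wp; rewrite wE e.
  by apply: ler_sum => a _; exact: dist_H3_bdry_ge.
have Jle : J (g p) <= J (shadow w).
  by have [->//|/eqP/Jlt/ltW] := eqVneq (shadow w) (g p).
apply: (le_lt_trans Jle).
have [z zs wz] : exists2 z, z \in s & shadow w != g z.
  have [wx|wx] := eqVneq (shadow w) (g x); last by exists x.
  by exists y => //; rewrite wx (inj_eq (isometric_inj gP)).
apply: (@ltr_sum_exists _ _ _ _ _ (g z)).
- by move=> a; exact: dist_H3_bdry_ge.
- exact: map_f.
- exact: dist_H3_bdry_gt.
Qed.

(** * Complex roots of a real form without real roots *)

Lemma dehomogenize_real {R : realType} (F : mpoly.mpoly 2 R) :
  map_poly (@conjc R) (dehomogenize F) = dehomogenize F.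
Proof.
rewrite /dehomogenize /mpoly.mmap raddf_sum/=; apply: eq_bigr => m _.
rewrite rmorphM; congr (_ * _).
  by rewrite /= map_polyC; congr polyC; exact: conjc_real.
rewrite /mpoly.mmap1 rmorph_prod; apply: eq_bigr => i _.
rewrite rmorphXn /=; congr (_ ^+ _).
by case: i => [[|[|i]] ?] //=; rewrite /tnth /= ?map_polyX ?rmorph1.
Qed.

Lemma horner_dehomogenize {R : realType} (F : mpoly.mpoly 2 R) (x : R) :
  (dehomogenize F).[real_complex R x] = real_complex R (form_eval F x 1).
Proof.
rewrite /dehomogenize /form_eval /mpoly.meval /mpoly.mmap.
rewrite horner_sum rmorph_sum/=.
apply: eq_bigr => m _; rewrite hornerM /= hornerC rmorphM; congr (_ * _).
rewrite /mpoly.mmap1 horner_prod rmorph_prod; apply: eq_bigr => i _.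
rewrite horner_exp rmorphXn /=; congr (_ ^+ _).
by case: i => [[|[|i]] ?] //=; rewrite /tnth /= ?hornerX ?hornerC.
Qed.

(** Nonvanishing of the leading coefficient, i.e. of the polynomial: otherwise
    [complex_roots F] could be any list. *)
Lemma complex_rootsP {R : realType} (F : mpoly.mpoly 2 R) :
  no_real_root F ->
  dehomogenize F = lead_coef (dehomogenize F)
    *: \prod_(z <- complex_roots F) ('X - z%:P)
  /\ lead_coef (dehomogenize F) != 0.
Proof.
move=> nF; split; first exact: svalP (closed_field_poly_normal _).
rewrite lead_coef_eq0; apply/eqP => F0.
have := horner_dehomogenize F 0; rewrite F0 horner0 => /esym/eqP.
rewrite fmorph_eq0 => /eqP/nF[_ /eqP].
by rewrite oner_eq0.
Qed.

Lemma complex_roots_Im {R : realType} (F : mpoly.mpoly 2 R) z :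
  no_real_root F -> z \in complex_roots F -> complex.Im z != 0.
Proof.
move=> nF zF; apply/eqP => z0.
have [FE l0] := complex_rootsP nF.
have : root (dehomogenize F) z by rewrite FE rootZ ?root_prod_XsubC.
have -> : z = real_complex R (complex.Re z) by case: z z0 {zF} => x y /= ->.
rewrite rootE horner_dehomogenize fmorph_eq0 => /eqP/nF[_ /eqP].
by rewrite oner_eq0.
Qed.

(** The dehomogenized form is its own conjugate, and a list of roots is
    determined up to order by the product of its linear factors. *)
Lemma complex_roots_conj {R : realType} (F : mpoly.mpoly 2 R) :
  no_real_root F ->
  perm_eq (complex_roots F) (map (@conjc R) (complex_roots F)).
Proof.
move=> nF; have [FE l0] := complex_rootsP nF.
apply: prod_XsubC_eq; apply: (scalerI l0); rewrite -FE.
have lE : conjc (lead_coef (dehomogenize F)) = lead_coef (dehomogenize F).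
  by rewrite -[LHS]lead_coef_map dehomogenize_real.
by rewrite big_map -map_prod_XsubC -{1}lE -map_polyZ -FE dehomogenize_real.
Qed.

Lemma conjc_Im {R : realType} (z : R[i]) :
  complex.Im (conjc z) = - complex.Im z.
Proof. by case: z. Qed.

Lemma complex_roots_perm {R : realType} (F : mpoly.mpoly 2 R) :
  no_real_root F ->
  perm_eq (complex_roots F)
    (map val (upper_roots F) ++ map (fun a => conjc (val a)) (upper_roots F)).
Proof.
move=> nF; rewrite [X in _ ++ X](map_comp (@conjc R) val).
pose up (z : R[i]) := 0 < complex.Im z.
have -> : map val (upper_roots F) = [seq z <- complex_roots F | up z].
  rewrite /upper_roots (pmap_filter (insubK _)).
  by apply: eq_filter => z; exact: isSome_insub.
rewrite -(permPl (permEl (perm_filterC up _))) perm_cat2l.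
apply: (perm_trans (perm_filter _ (complex_roots_conj nF))).
rewrite filter_map.
suff -> : [seq z <- complex_roots F | preim (@conjc R) (predC up) z]
  = [seq z <- complex_roots F | up z] by [].
apply: eq_in_filter => z /(complex_roots_Im nF) z0.
by rewrite /= /up conjc_Im oppr_gt0 -leNgt le_eqVlt eq_sym (negPf z0).
Qed.

Lemma sum_complex_roots {R : realType} (F : mpoly.mpoly 2 R) (f : R[i] -> R) :
  no_real_root F ->
  \sum_(b <- complex_roots F) f b
  = \sum_(a <- upper_roots F) (f (val a) + f (conjc (val a))).
Proof.
move=> nF; rewrite (perm_big _ (complex_roots_perm nF)) big_cat !big_map.
by rewrite big_split.
Qed.

Lemma size_complex_roots {R : realType} (F : mpoly.mpoly 2 R) :
  no_real_root F -> size (complex_roots F) = (size (upper_roots F)).*2.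
Proof.
move=> nF; rewrite (perm_size (complex_roots_perm nF)).
by rewrite size_cat !size_map addnn.
Qed.

(** Each upper root has the same multiplicity as its conjugate, at most half the
    degree, and equal to it only if all the upper roots coincide. *)
Lemma stableP {R : realType} (F : mpoly.mpoly 2 R) (d : nat) :
  no_real_root F -> d = (size (upper_roots F)).*2 -> (0 < d)%N ->
  reflect (exists x y, [/\ x \in upper_roots F, y \in upper_roots F & x != y])
          (stable d F).
Proof.
move=> nF dE d0; rewrite /stable size_complex_roots// -dE subnn d0 /=.
rewrite (perm_all _ (complex_roots_perm nF)) all_cat.
set U := upper_roots F in dE *.
have countE (b : R[i]) : count_mem b (complex_roots F)
    = (count (fun a => val a == b) U + count (fun a => conjc (val a) == b) U)%N.
  rewrite (permP (complex_roots_perm nF)) count_cat !count_map.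
  by congr (_ + _)%N; apply: eq_count => a.
have Ipos (a : H2 R) (b : H2 R) : (conjc (val a) == val b) = false.
  apply/eqP => /(congr1 (@complex.Im R)); rewrite conjc_Im.
  by have := H2P a; have := H2P b; lra.
have Ineg (a : H2 R) (b : H2 R) : (val a == conjc (val b)) = false.
  by rewrite eq_sym Ipos.
have c1 (b : H2 R) : count_mem (val b) (complex_roots F) = count_mem b U.
  rewrite countE (eq_count (Ipos^~ b)) count_pred0 addn0.
  by apply: eq_count => a; rewrite (inj_eq val_inj).
have c2 (b : H2 R) :
    count_mem (conjc (val b)) (complex_roots F) = count_mem b U.
  rewrite countE (eq_count (Ineg^~ b)) count_pred0 add0n.
  apply: eq_count => a.
  by rewrite (inj_eq (can_inj (@conjcK R))) (inj_eq val_inj).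
have allU f : (forall b, count_mem (f b) (complex_roots F) = count_mem b U) ->
    all (fun z => ((count_mem z (complex_roots F)).*2 < d)%N) (map f U)
    = all (fun b => (count_mem b U < size U)%N) U.
  move=> cf; rewrite all_map; apply: eq_all => b.
  by rewrite /= cf dE ltn_double.
rewrite !allU// andbb.
have U0 : (0 < size U)%N by rewrite -double_gt0 -dE.
apply: (iffP allP) => [cU|[x [y [xU yU xy]]] b bU].
  case EU : U U0 => [//|x r] _.
  have xU : x \in U by rewrite EU mem_head.
  have := cU _ xU; rewrite -(count_predC (pred1 x)) -[X in (X < _)%N]addn0.
  rewrite ltn_add2l -has_count => /hasP[y yU /= yx].
  by exists y, x; rewrite -EU.
rewrite -(count_predC (pred1 b)) -[X in (X < _)%N]addn0 ltn_add2l -has_count.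
apply/hasP; have [xb|xb] := eqVneq x b; last by exists x.
by exists y => //=; rewrite -xb eq_sym.
Qed.

(** * The two zeros as balance points *)

Lemma range_map {T : Type} {U : eqType} (g : T -> U) (l : seq U) :
  (forall a, a \in l -> range g a) -> exists s, l = map g s.
Proof.
elim: l => [|a l IH] lg; first by exists [::].
have [x _ xa] := lg a (mem_head _ _).
have [|s ->] := IH; first by move=> b bl; apply: lg; rewrite inE bl orbT.
by exists (x :: s); rewrite /= xa.
Qed.

Lemma hyperbolic_zeroE {R : realType} (F : mpoly.mpoly 2 R) (g : R -> H2 R)
    (s : seq R) (p : R) :
  isometric g -> perm_eq (map g s) (upper_roots F) -> s != [::] ->
  \sum_(x <- s) sinh (x - p) = 0 -> hyperbolic_zero F = g p.
Proof.
move=> gP sF s0 sh0; apply: xget_unique_minimizer.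
rewrite (_ : (fun Q => _) = fun Q => \sum_(a <- map g s) cosh (dist_H2 Q a)).
  exact: hyperbolic_minimizer.
by apply/funext => Q; apply/esym/perm_big.
Qed.

(** In the unstable case all the positions agree, and vanishing of the sum of
    [tanh] forces them to be [p]; so the convention for unstable forms agrees
    with the balance condition. *)
Lemma julia_zeroE {R : realType} (F : mpoly.mpoly 2 R) (g : R -> H2 R)
    (s : seq R) (p : R) :
  no_real_root F ->
  isometric g -> perm_eq (map g s) (upper_roots F) -> s != [::] ->
  \sum_(x <- s) tanh (x - p) = 0 ->
  julia_zero (size s).*2 F = H2_to_H3 (g p).
Proof.
move=> nF gP sF s0 th0; rewrite /julia_zero.
have sizeU : size (upper_roots F) = size s by rewrite -(perm_size sF) size_map.
have n0 : (0 < size s)%N by rewrite lt0n size_eq0.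
case: (stableP nF (esym (congr1 double sizeU))); rewrite ?double_gt0//.
  move=> [a [b [aU bU ab]]]; apply: xget_unique_minimizer.
  rewrite (_ : (fun w => _) = fun w => \sum_(a <- map g s)
    (dist_H3_bdry w (val a) + dist_H3_bdry w (conjc (val a)))).
    apply: julia_minimizer => //.
    move: aU bU; rewrite -!(perm_mem sF) => /mapP[x xs ax] /mapP[y ys yb].
    by exists x, y; split=> //; apply: contra_neq ab => xy; rewrite ax yb xy.
  by apply/funext => w; rewrite sum_complex_roots//; apply/esym/perm_big.
move=> eqU; congr H2_to_H3; set h := head _ _.
have hU : h \in upper_roots F.
  rewrite /h; case: (upper_roots F) sizeU n0 => [<-//|a r] _ _.
  exact: mem_head.
have := hU; rewrite -(perm_mem sF) => /mapP[x xs hx]; rewrite hx; congr g.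
have sx y : y \in s -> y = x.
  move=> ys; apply: (isometric_inj gP); apply/eqP/negPn/negP => yx.
  by apply: eqU; exists (g y), (g x); rewrite -!(perm_mem sF) !map_f.
move/eqP: th0; rewrite (eq_big_seq (fun=> tanh (x - p))) => [|y /sx -> //].
rewrite big_const_seq count_predT iter_addr_0 mulrn_eq0 -leqn0 leqNgt n0 /=.
rewrite mulf_eq0 sinh_eq0 invr_eq0 (gt_eqF (cosh_gt0 _)) orbF subr_eq0.
by move/eqP.
Qed.

Theorem proposition13 (R : realType) (F : mpoly.mpoly 2 R)
    (alpha : 4.-tuple (H2 R)) (P : H2 R) :
  binary_form 8 F ->
  no_real_root F ->
  perm_eq alpha (upper_roots F) ->
  (exists2 L : set (H2 R), is_geodesic L & forall a, a \in alpha -> L a) ->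
  (julia_zero 8 F = H2_to_H3 P /\ hyperbolic_zero F = P) <->
  (exists a b c d : H2 R,
     [/\ perm_eq alpha [:: a; b; c; d], is_midpoint a b P & is_midpoint c d P]).
Proof.
move=> _ nF alphaF [L [g gP ->]] alphaL.
have {alphaL} [s alphaE] := range_map alphaL.
split=> [[julia hyp]|[a [b [c [d [abcd Pab Pcd]]]]]].
  have s4 : size s = 4 by rewrite -(size_map g) -alphaE size_tuple.
  have s0 : s != [::] by case: (s) s4.
  rewrite alphaE in alphaF *.
  have [p th0] := odd_balance s (@continuous_tanh R) tanhN (@tanh_ge0 R).
  have [q sh0] := odd_balance s (@continuous_sinh R) sinhN (@sinh_ge0 R).
  have Pp : P = g p.
    apply: H2_to_H3_inj.
    by rewrite -julia -(julia_zeroE nF gP alphaF s0 th0) s4.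
  have pq : q = p.
    apply: (isometric_inj gP).
    by rewrite -Pp -hyp (hyperbolic_zeroE gP alphaF s0 sh0).
  rewrite {q}pq in sh0.
  have mid x y : x - p + (y - p) = 0 -> is_midpoint (g x) (g y) P.
    by move=> xy; apply/(midpoint_isometric _ _ _ gP); rewrite Pp; congr g; lra.
  case: s s4 th0 sh0 {alphaE alphaF s0} => [//|a [//|b [//|c [//|d [|//]]]]] _.
  rewrite !big_cons !big_nil !addr0 !addrA => th0 sh0.
  case: (sinh_tanh_cancel sh0 th0) => -[/mid m1 /mid m2].
  - by exists (g a), (g b), (g c), (g d).
  - exists (g a), (g c), (g b), (g d); split=> //=.
    rewrite perm_cons.
    exact: (permEl (perm_catCA [:: g b] [:: g c] [:: g d])).
  - exists (g a), (g d), (g b), (g c); split=> //=.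
    by rewrite perm_cons; exact: (permEl (perm_catC [:: g b; g c] [:: g d])).
(* The pairing fixes an order of the roots, hence a new list of positions. *)
have [s' abcdE] : exists s', [:: a; b; c; d] = map g s'.
  apply: range_map => e; rewrite -(perm_mem abcd) alphaE => /mapP[x _ ->].
  by exists x.
case: s' abcdE => [//|x [//|y [//|z [//|t [|//]]]]] abcdE.
case: (abcdE) => ax by' cz dt; subst a b c d.
have s'F : perm_eq (map g [:: x; y; z; t]) (upper_roots F).
  by rewrite -(permPr alphaF) perm_sym.
move/(midpoint_isometric _ _ _ gP): Pab => Pxy.
move/(midpoint_isometric _ _ _ gP): Pcd.
rewrite Pxy => /(isometric_inj gP) pE.
set p := (x + y) / 2 in pE *.
have ey : y - p = - (x - p) by rewrite /p; field.
have et : t - p = - (z - p) by rewrite pE; field.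
split.
  apply: (@julia_zeroE R F g [:: x; y; z; t] p) => //.
  by rewrite !big_cons big_nil ey et !tanhN; ring.
apply: (@hyperbolic_zeroE R F g [:: x; y; z; t] p) => //.
by rewrite !big_cons big_nil ey et !sinhN; ring.
Qed.
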